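(* Let $n\geq 4$ be even. Let $\Psi$ be an instance of $\{1,2\}$-CSP whose graph $G$ is connected and bipartite, and assume $\mathbf{P}_\infty\models\Psi$. Then the following are equivalent: (I) $\mathbf{P}_n\models\Psi$; (II) Prover has a winning strategy in the game $\mathscr{G}(\Psi,\mathbf{P}_n)$; (III) there is no vertex $v$ of $G$ with $\gamma(v)\geq n/2$.
   Context: $\mathbf{P}_n$ is the path on $\{1,\ldots,n\}$, $\mathbf{P}_\infty$ the path on $\mathbb{Z}$ (edges between integers at distance 1). An instance $\Psi$ of $\{1,2\}$-CSP is a sentence in which each variable $v$ is quantified by $\exists^{\geq\beta(v)}$, $\beta(v)\in\{1,2\}$ ($\exists^{\geq j}$: at least $j$ distinct elements), followed by a conjunction of atoms $E(v_i,v_k)$; $G$ is the graph on the variables with an edge for each atom and $\prec$ the quantification order; for sets $X\prec Y$ means $x\prec y$ for all $x\in X,y\in Y$. Game $\mathscr{G}(\Psi,\mathbf{B})$: in order $\prec$, for each $v$ Prover offers $\beta(v)$ distinct elements of $\mathbf{B}$ and Adversary picks one as $f(v)$; Prover wins if $f$ is a homomorphism $G\to\mathbf{B}$. For a walk $Q=x_1,\ldots,x_r$, $|Q|=r-1$ and $\lambda(Q)=|Q|-2\sum_{i=2}^{r-1}(\beta(x_i)-1)$. A walk is looping if $x_1\neq x_r$ and, when $r\geq 3$, $\{x_1,x_r\}\prec\{x_2,\ldots,x_{r-1}\}$ and there is $\ell\notin\{1,r\}$ with $x_1,\ldots,x_\ell$ and $x_\ell,\ldots,x_r$ both looping (for $r=2$: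 two distinct adjacent vertices). $\delta(u,v)$ is the minimum $\lambda(Q)$ over looping walks with endpoints $u,v$, and $\infty$ if none. $\gamma$ is defined recursively along $\prec$: $\gamma(v)=0$ if $v$ is the first vertex; otherwise $\gamma(v)=\beta(v)-1+\max\{0,\max_{u\prec v}(\gamma(u)-\delta(u,v)+\beta(v)-1)\}$ (terms with $\delta(u,v)=\infty$ contribute $-\infty$). *)

(* Defs.v *)
From HB Require Import structures.
From mathcomp Require Import all_boot all_order all_algebra.
From mathcomp Require Import boolp classical_sets.
From mathcomp Require Import zify.

Set Implicit Arguments.
Unset Strict Implicit.
Unset Printing Implicit Defensive.

Import Order.TTheory GRing.Theory Num.Theory.

Local Open Scope ring_scope.

(* The variables are the elements of 'I_(nvars Psi), quantified in increasing
   order, so that the quantification order is < on 'I_(nvars Psi). *)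
Record instance := Instance {
  nvars : nat;
  beta : 'I_nvars -> nat;
  beta12 : forall v, beta v \in [:: 1%N; 2%N];
  atoms : seq ('I_nvars * 'I_nvars)
}.

Notation var Psi := 'I_(nvars Psi).

Definition adj (Psi : instance) : rel (var Psi) :=
  [rel u v | ((u, v) \in atoms Psi) || ((v, u) \in atoms Psi)].

Definition connected (Psi : instance) : Prop :=
  forall u v : var Psi, connect (@adj Psi) u v.

Definition bipartite (Psi : instance) : Prop :=
  exists c : var Psi -> bool, forall u v, adj u v -> c u != c v.

Section Semantics.

Variables (B : eqType) (E : rel B).

Definition exists_ge (j : nat) (P : B -> Prop) : Prop :=
  exists s : seq B, [/\ uniq s, (j <= size s)%N & forall x, x \in s -> P x].

Fixpoint exists_ge_prefix (m : nat) :
    ('I_m -> nat) -> (m.-tuple B -> Prop) -> Prop :=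
  match m with
  | 0 => fun _ phi => phi [tuple]
  | m'.+1 => fun b phi =>
      exists_ge (b ord0) (fun x =>
        exists_ge_prefix (fun i => b (lift ord0 i))
          (fun t => phi (cons_tuple x t)))
  end.

Definition models (Psi : instance) : Prop :=
  exists_ge_prefix (@beta Psi) (fun f =>
    forall u v, (u, v) \in atoms Psi -> E (tnth f u) (tnth f v)).

Definition homomorphism (Psi : instance) (f : (nvars Psi).-tuple B) : Prop :=
  forall u v, adj u v -> E (tnth f u) (tnth f v).

(* A strategy of Prover maps the sequence of Adversary's past choices to the
   elements offered for the next variable. *)
Definition legal (Psi : instance) (sigma : seq B -> seq B) : Prop :=
  forall (v : var Psi) (h : v.-tuple B),
    uniq (sigma h) /\ size (sigma h) = beta v.

Definition play (Psi : instance) (sigma : seq B -> seq B)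
    (f : (nvars Psi).-tuple B) : Prop :=
  forall v : var Psi, tnth f v \in sigma (take v f).

Definition prover_wins (Psi : instance) : Prop :=
  exists2 sigma : seq B -> seq B, legal Psi sigma &
    forall f : (nvars Psi).-tuple B, play sigma f -> homomorphism f.

End Semantics.

Definition path_infty : rel int := [rel x y | `|x - y| == 1].

(* The vertex i : 'I_n stands for i + 1 in {1, ..., n}. *)
Definition path_fin (n : nat) : rel 'I_n :=
  [rel i j : 'I_n | `|i%:Z - j%:Z| == 1].

Section Walks.

Variable Psi : instance.

(* [looping x s y]: the walk x, s, y with endpoints x, y and interior s is
   looping; that consecutive vertices are adjacent follows from the base
   case. *)
Inductive looping : var Psi -> seq (var Psi) -> var Psi -> Prop :=
| looping_edge (x y : var Psi) : x != y -> adj x y -> looping x [::] y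
| looping_glue (x y z : var Psi) (p q : seq (var Psi)) :
    x != y ->
    (forall w, w \in p ++ z :: q -> (x < w)%N && (y < w)%N) ->
    looping x p z -> looping z q y -> looping x (p ++ z :: q) y.

(* lambda of a walk with two endpoints and interior s; its length is
   size s + 1. *)
Definition lambda (s : seq (var Psi)) : int :=
  (size s).+1%:Z - 2 * \sum_(w <- s) ((beta w)%:Z - 1).

(* None stands for infinity. *)
Definition is_delta (u v : var Psi) (d : option int) : Prop :=
  match d with
  | Some k => (exists2 s, looping u s v & lambda s = k) /\
              (forall s, looping u s v -> k <= lambda s)
  | None => forall s, ~ looping u s v
  end.

(* By deltaP below, the default value of xget is never used for lack of a
   minimum. *)
Definition delta (u v : var Psi) : option int := xget None (is_delta u v).

(* The first argument bounds the depth of the recursion; see gammaE. Pairs at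
   infinite distance are left out of the maximum. *)
Fixpoint gamma_rec (k : nat) (v : var Psi) : int :=
  if k is k'.+1 then
    if v == 0%N :> nat then 0
    else (beta v)%:Z - 1 +
      \big[Num.max/0]_(u : var Psi | (u < v)%N && isSome (delta u v))
        (gamma_rec k' u - odflt 0 (delta u v) + (beta v)%:Z - 1)
  else 0.

Definition gamma (v : var Psi) : int := gamma_rec v.+1 v.

Lemma gammaE (v : var Psi) :
  gamma v =
    if v == 0%N :> nat then 0
    else (beta v)%:Z - 1 +
      \big[Num.max/0]_(u : var Psi | (u < v)%N && isSome (delta u v))
        (gamma u - odflt 0 (delta u v) + (beta v)%:Z - 1).
Proof.
have rec_fuel k j (u : var Psi) :
    (u < k)%N -> (u < j)%N -> gamma_rec k u = gamma_rec j u.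
  elim: k j u => [//|k IHk] [//|j] u uk uj /=; case: ifP => // _.
  by congr (_ + _); apply: eq_bigr => w /andP[wu _]; rewrite (IHk j) //; lia.
rewrite {1}/gamma /=; case: ifP => // _; congr (_ + _).
by apply: eq_bigr => u /andP[uv _]; rewrite (rec_fuel _ u.+1).
Qed.

Lemma looping_size (x : var Psi) s (y : var Psi) : looping x s y ->
  (size s < 2 ^ (nvars Psi - x))%N /\ (size s < 2 ^ (nvars Psi - y))%N.
Proof.
elim=> {x s y} [x y _ _|x y z p q _ ltw _ [_ sp] _ [sq _]].
  by rewrite !expn_gt0.
have /andP[xz yz] : (x < z)%N && (y < z)%N.
  by apply: ltw; rewrite mem_cat inE eqxx orbT.
have zm := ltn_ord z.
suff bnd (t : nat) : (t < z)%N -> (size (p ++ z :: q) < 2 ^ (nvars Psi - t))%N.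
  by split; apply: bnd.
move=> tz; have : (2 ^ (nvars Psi - z).+1 <= 2 ^ (nvars Psi - t))%N.
  by rewrite leq_exp2l //; lia.
by rewrite expnS size_cat /=; lia.
Qed.

Lemma lambda_ge (s : seq (var Psi)) : - (size s)%:Z <= lambda s.
Proof.
suff : \sum_(w <- s) ((beta w)%:Z - 1) <= (size s)%:Z by rewrite /lambda; lia.
elim: s => [|w s IHs]; first by rewrite big_nil.
rewrite big_cons /=; move: (\sum_(_ <- s) _) IHs => S IHs.
by have := beta12 w; rewrite !inE => /orP[] /eqP ->; lia.
Qed.

Lemma deltaP (u v : var Psi) : is_delta u v (delta u v).
Proof.
suff [d dP] : exists d, is_delta u v d by apply: (xgetI None dP).
have [[s0 lp0]|no] := pselect (exists s, looping u s v); last first.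
  by exists None => s lp; apply: no; exists s.
pose N := (2 ^ (nvars Psi - u))%N.
have lb s : looping u s v -> 0 <= lambda s + N%:Z.
  by move=> /looping_size[+ _]; have := lambda_ge s; rewrite -/N; lia.
pose P k := `[< exists2 s, looping u s v & lambda s + N%:Z = k%:Z >].
have exP : exists k, P k.
  exists (absz (lambda s0 + N%:Z)); apply/asboolP; exists s0 => //.
  by have := lb _ lp0; lia.
case: (ex_minnP exP) => k /asboolP[s lps ks] kmin.
exists (Some (lambda s)); split; first by exists s.
move=> t lpt; have : (k <= absz (lambda t + N%:Z)%R)%N.
  by apply: kmin; apply/asboolP; exists t => //; have := lb _ lpt; lia.
by have := lb _ lpt; lia.
Qed.

End Walks.

(* Main.v *)
(* A looping walk Q from u to v forces |f u - f v| <= lambda Q in every position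
   won by Prover: Adversary replies at the last vertex glued with the farther of
   two values, which by parity differ by at least 2. Following the vertices
   where the maximum in gamma is reached, Adversary thus drives some f v to
   distance at least gamma v + 1/2 from the centre of the path. Conversely,
   Prover can keep |f u - f v| <= delta u v and f v within gamma v + 1/2 of the
   centre: the admissible values for the next vertex form an intersection of
   intervals, and the pairwise conditions of Helly's theorem on the line are
   exactly the inequalities between delta and gamma, together with
   beta v - 1 <= delta u v, which holds because Prover wins on the infinite
   path. *)

Require Import Defs.
From mathcomp Require Import all_boot all_order all_algebra.
From mathcomp Require Import boolp zify.

Set Implicit Arguments.
Unset Strict Implicit.
Unset Printing Implicit Defensive.

Import Order.TTheory GRing.Theory Num.Theory.

Local Open Scope ring_scope.

(* Without this, looping is the function on orbits of MathComp's path. *)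
Local Notation looping := Defs.looping.

(* A strategy as a set of histories: it contains the empty one, Prover can stay
   in it whatever Adversary picks, and its complete plays are won. *)
Definition winning (B : eqType) (E : rel B) (Psi : instance)
    (Pos : seq B -> Prop) : Prop :=
  [/\ Pos [::],
      forall (v : var Psi) h, size h = v -> Pos h ->
        exists_ge (beta v) (fun x => Pos (rcons h x)) &
      forall t : (nvars Psi).-tuple B, Pos t -> homomorphism E t].

(** * Winning sets of positions, quantified formulas and strategies *)

Section Positions.

Variables (B : eqType) (E : rel B).

Lemma exists_ge_prefixP (m : nat) (b : 'I_m -> nat) (phi : m.-tuple B -> Prop) :
  exists_ge_prefix b phi <->
  exists Pos : seq B -> Prop,
    [/\ Pos [::],
        forall (i : 'I_m) h, size h = i -> Pos h ->
          exists_ge (b i) (fun x => Pos (rcons h x)) &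
        forall t : m.-tuple B, Pos t -> phi t].
Proof.
elim: m b phi => [|m IHm] b phi /=.
  split=> [phi0|[Pos [Pos0 _]]]; last exact.
  exists xpredT; split=> // [[] //|t _]; by rewrite tuple0.
split=> [[s [us sb Ps]]|[Pos [Pos0 PosS PosT]]].
  pose good x (Q : seq B -> Prop) := [/\ Q [::],
    forall (i : 'I_m) h, size h = i -> Q h ->
      exists_ge (b (lift ord0 i)) (fun y => Q (rcons h y)) &
    forall t : m.-tuple B, Q t -> phi (cons_tuple x t)].
  (* The union of all sets good for the first element [x]: each history carries its own [Q], so none
     has to be selected. *)
  exists (fun h => if h is x :: h' then exists2 Q, good x Q & Q h' else True).
  split=> // [i [|x h] /= hi|t].
  - have -> : i = ord0 by apply: val_inj.
    move=> _; exists s; split=> // x xs.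
    have /IHm[Q Qgood] := Ps x xs.
    by exists Q => //; case: Qgood.
  - case=> Q Qgood Qh.
    have im : (size h < m)%N by rewrite -ltnS hi.
    have ei : lift ord0 (Ordinal im) = i by apply: val_inj.
    case: (Qgood) => _ /(_ (Ordinal im) h erefl Qh) + _; rewrite ei.
    case=> s' [us' sb' Qs']; exists s'; split=> // y ys'.
    by exists Q => //; apply: Qs'.
  - case/tupleP: t => x t /= [Q [_ _ QT] Qt].
    exact: QT.
have [s [us sb Ps]] := PosS ord0 [::] erefl Pos0.
exists s; split=> // x xs; apply/IHm; exists (fun h => Pos (x :: h)); split.
- exact: Ps.
- by move=> i h hi Ph; apply: (PosS (lift ord0 i) (x :: h)); rewrite //= hi.
- by move=> t Pt; apply: PosT.
Qed.

Lemma modelsP (Psi : instance) : symmetric E ->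
  models E Psi <-> exists Pos, winning E Psi Pos.
Proof.
move=> symE; rewrite /models exists_ge_prefixP.
split=> -[Pos [Pos0 PosS PosT]]; exists Pos; split=> // t /PosT.
  by move=> Et u v /orP[/Et//|/Et]; rewrite symE.
by move=> Et u v uv; apply: Et; rewrite /adj /= uv.
Qed.

(** [legal] demands [beta v] distinct elements even at histories outside [Pos]; [a] and [b] supply
    the offer there. *)
Lemma prover_winsP (Psi : instance) (a b : B) : a != b ->
  prover_wins E Psi <-> exists Pos, winning E Psi Pos.
Proof.
move=> ab; split=> [[sigma lsigma wsigma]|[Pos [Pos0 PosS PosT]]].
  exists (fun h => forall x0 i, (i < size h)%N -> nth x0 h i \in sigma (take i h)).
  split=> // [v h hv Ph|t Pt]; last first.
    apply: wsigma => v; rewrite (tnth_nth a); apply: Pt.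
    by rewrite size_tuple.
  have [us ss] := lsigma v (tcast hv (in_tuple h)).
  rewrite val_tcast in us ss.
  exists (sigma h); split=> [||x xs x0 i]; rewrite ?ss //.
  rewrite size_rcons ltnS nth_rcons leq_eqVlt => /orP[/eqP ->|ih].
    by rewrite ltnn eqxx -cats1 take_size_cat.
  by rewrite ih -cats1 takel_cat ?Ph // ltnW.
have /choice[sigma sigmaP] : forall h, exists s, forall v : var Psi, size h = v ->
    [/\ uniq s, size s = beta v & Pos h -> forall x, x \in s -> Pos (rcons h x)].
  move=> h; case: (ltnP (size h) (nvars Psi)) => [hn|nh]; last first.
    by exists [::] => v hv; have := ltn_ord v; rewrite -hv ltnNge nh.
  have vE (v : var Psi) : size h = v -> v = Ordinal hn by move=> hv; apply: val_inj.
  have [Ph|nPh] := pselect (Pos h).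
    have [s [us ss Ps]] := PosS (Ordinal hn) h erefl Ph.
    (* [exists_ge] may give more elements than a legal offer contains. *)
    exists (take (beta (Ordinal hn)) s) => v /vE ->.
    by split=> [||_ x /mem_take/Ps//]; rewrite ?take_uniq // size_takel.
  exists (take (beta (Ordinal hn)) [:: a; b]) => v /vE ->.
  have := beta12 (Ordinal hn); rewrite !inE.
  by case/orP=> /eqP -> /=; rewrite ?inE ?ab; split=> // /nPh.
exists sigma => [v h|f pf].
  by have [] := sigmaP h v; rewrite ?size_tuple.
have Ptake k : (k <= nvars Psi)%N -> Pos (take k f).
  elim: k => [|k IHk] kn; first by rewrite take0.
  have := pf (Ordinal kn); rewrite (tnth_nth a) => fk.
  rewrite (take_nth a) ?size_tuple //.
  have [] := sigmaP (take k f) (Ordinal kn); rewrite ?size_takel ?size_tuple // 1?ltnW //.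
  by move=> _ _ /(_ (IHk (ltnW kn))); apply.
by have := Ptake _ (leqnn _); rewrite take_oversize ?size_tuple //; apply: PosT.
Qed.

End Positions.

(** * Transfer between the finite and the infinite path *)

Lemma path_infty_sym : symmetric path_infty.
Proof. by move=> x y; rewrite /path_infty /= distrC. Qed.

Lemma path_fin_sym n : symmetric (@path_fin n).
Proof. by move=> x y; rewrite /path_fin /= distrC. Qed.

Lemma winning_fin_infty n Psi (Pos : seq 'I_n -> Prop) :
  winning (@path_fin n) Psi Pos ->
  winning path_infty Psi
    (fun h => exists2 g : seq 'I_n, Pos g & h = [seq (nat_of_ord i)%:Z | i <- g]).
Proof.
case=> Pos0 PosS PosT; split=> [|v h hv [g Pg hg]|t [g Pg tg]].
- by exists [::].
- move: hv; rewrite hg size_map => gv.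
  have [s [us ss Ps]] := PosS v g gv Pg.
  exists [seq (nat_of_ord i)%:Z | i <- s]; split; rewrite ?size_map //.
    by rewrite map_inj_uniq // => i j [] /val_inj.
  by move=> _ /mapP[i /Ps Pi ->]; exists (rcons g i) => //; rewrite map_rcons.
have sg : size g == nvars Psi by rewrite -(size_tuple t) tg size_map.
move=> u v /(PosT (Tuple sg) Pg); rewrite /path_fin /path_infty /=.
have x0 := tnth (Tuple sg) u.
rewrite !(tnth_nth 0) !(tnth_nth x0) tg !(nth_map x0) //;
  by rewrite (eqP sg) ltn_ord.
Qed.

Lemma winning_infty_fin n Psi (Pos : seq int -> Prop) : (0 < n)%N ->
  winning path_infty Psi Pos ->
  (forall h, Pos h -> (size h <= nvars Psi)%N ->
     {in h, forall x, 0 <= x < n%:Z}) ->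
  winning (@path_fin n) Psi (fun g => Pos [seq (nat_of_ord i)%:Z | i <- g]).
Proof.
case: n => // n _ [Pos0 PosS PosT] bnd; split=> // [v h hv Ph|t Pt].
  have [|s [us ss Ps]] := PosS v _ _ Ph; first by rewrite size_map.
  have sb x : x \in s -> 0 <= x < n.+1%:Z.
    move=> xs; apply: (bnd _ (Ps x xs)); last by rewrite mem_rcons inE eqxx.
    by rewrite size_rcons size_map hv.
  have inK x : x \in s -> (nat_of_ord (inord `|x|%N : 'I_n.+1))%:Z = x.
    by move=> /sb bx; rewrite inordK; lia.
  exists [seq inord `|x|%N | x <- s]; split; rewrite ?size_map //.
    rewrite map_inj_in_uniq // => x y xs ys e.
    by rewrite -(inK x xs) -(inK y ys) e.
  by move=> _ /mapP[x xs ->]; rewrite map_rcons inK //; apply: Ps.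
move=> u v /(PosT [tuple of [seq (nat_of_ord i)%:Z | i <- t]] Pt).
by rewrite !tnth_map.
Qed.

(** * Reversal, gluing and parity of looping walks *)

Section WinningPositions.

Variables (Psi : instance) (c : var Psi -> bool).
Hypothesis conn : connected Psi.
Hypothesis c_adj : forall u v : var Psi, adj u v -> c u != c v.

Lemma beta_bounds (v : var Psi) : (1 <= beta v <= 2)%N.
Proof. by have := beta12 v; rewrite !inE => /orP[] /eqP ->. Qed.

Lemma adj_sym : symmetric (@adj Psi).
Proof. by move=> u v; rewrite /adj /= orbC. Qed.

Lemma looping_rev (x y : var Psi) s : looping x s y -> looping y (rev s) x.
Proof.
elim=> {x y s} [x y xy axy|x y z p q xy ltw _ IHp _ IHq].
  by constructor; rewrite 1?eq_sym // adj_sym.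
rewrite rev_cat rev_cons cat_rcons; apply: looping_glue => //.
  by rewrite eq_sym.
move=> w win; rewrite andbC; apply: ltw; move: win.
by rewrite !mem_cat !inE !mem_rev orbC -orbA orbCA (orbC (w == z)) orbA orbAC -orbA.
Qed.

Lemma lambda_rev (s : seq (var Psi)) : lambda (rev s) = lambda s.
Proof.
rewrite /lambda size_rev; congr (_ - 2 * _).
by apply: perm_big; rewrite perm_rev.
Qed.

Lemma lambda_glue (p q : seq (var Psi)) z :
  lambda (p ++ z :: q) = lambda p + lambda q - 2 * ((beta z)%:Z - 1).
Proof.
rewrite /lambda big_cat big_cons size_cat /=.
by move: (\sum_(_ <- p) _) (\sum_(_ <- q) _) => S T; lia.
Qed.

(** Interior vertices contribute even numbers to [lambda], and every edge flips the colour [c]. *)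
Lemma looping_parity (x y : var Psi) s : looping x s y ->
  exists k : int, lambda s = (c x : nat)%:Z - (c y : nat)%:Z + 2 * k.
Proof.
elim=> {x y s} [x y xy /c_adj|x y z p q _ _ _ [k pk] _ [l ql]].
  rewrite /lambda big_nil /= => cxy.
  by exists (c y : nat)%:Z; case: (c x) (c y) cxy => [] [].
by exists (k + l - ((beta z)%:Z - 1)); rewrite lambda_glue pk ql; lia.
Qed.

(** * Adversary's side: what every winning set of positions must allow *)

Variable Pos : seq int -> Prop.
Hypothesis winP : winning path_infty Psi Pos.

Lemma pos_extend h k : Pos h -> (size h <= k <= nvars Psi)%N ->
  exists2 r, Pos (h ++ r) & size (h ++ r) = k.
Proof.
case: winP => _ PosS _ Ph; elim: k => [|k IHk] /andP[hk kn].
  by exists [::]; rewrite cats0 //; lia.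
move: hk; rewrite leq_eqVlt => /orP[/eqP hk|hk].
  by exists [::]; rewrite cats0.
have [|r Pr sr] := IHk; first by lia.
have [[|x s] [_ ss Ps]] := PosS (Ordinal kn) _ sr Pr.
  by move: ss (beta_bounds (Ordinal kn)); case: (beta _).
exists (rcons r x); rewrite -rcons_cat ?size_rcons ?sr //.
by apply: Ps; rewrite inE eqxx.
Qed.

(** Atoms are tested only on complete plays, so a partial position inherits their consequences from
    a won completion. *)
Lemma pos_full h : Pos h -> (size h <= nvars Psi)%N ->
  exists2 t : (nvars Psi).-tuple int, homomorphism path_infty t &
    forall u : var Psi, (u < size h)%N -> h`_u = tnth t u.
Proof.
move=> Ph hn; have [|r Pr /eqP sr] := pos_extend (k := nvars Psi) Ph.
  by rewrite hn leqnn.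
exists (Tuple sr) => [|u uh]; first by case: winP => _ _; apply.
by rewrite (tnth_nth 0) /= nth_cat uh.
Qed.

Lemma pos_parity h (u v : var Psi) : Pos h -> (size h <= nvars Psi)%N ->
  (u < size h)%N -> (v < size h)%N ->
  exists k : int, h`_u - h`_v = (c u : nat)%:Z - (c v : nat)%:Z + 2 * k.
Proof.
move=> Ph hn uh vh; have [t homt ht] := pos_full Ph hn.
rewrite !ht // {uh vh ht Ph}.
have /connectP[p + ->] := conn u v.
elim: p u => [|w p IHp] u /=; first by exists 0; lia.
case/andP=> uw /IHp[k wk].
have := homt _ _ uw; have := c_adj uw; rewrite /path_infty /= => cuw tuw.
move: wk; set z := last w p; move: (tnth t u) (tnth t w) (tnth t z) tuw.
move=> a b d /eqP ab wk.
(* The division is exact: [a - b] is 1 or -1, and the colours of [u] and [w] differ. *)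
exists (divz (a - b - (c u : nat)%:Z + (c w : nat)%:Z) 2 + k).
by case: (c u) (c w) cuw wk => [] [] //= _ wk; lia.
Qed.

(** The value of the first variable fixes the parity of all options for [v], so two distinct ones
    differ by at least 2. The first variable itself has no such reference, hence [0 < v]. *)
Lemma pos_options h (v : var Psi) : Pos h -> size h = v ->
  exists x y : int, [/\ Pos (rcons h x), Pos (rcons h y) &
    (0 < v)%N -> 2 * ((beta v)%:Z - 1) <= `|x - y|].
Proof.
move=> Ph hv; have vn := ltn_ord v; case: (winP) => _ PosS _.
have [s [us ss Ps]] := PosS v h hv Ph.
case: s us ss Ps => [|x [|y s]] us ss Ps.
- by move: ss (beta_bounds v); case: (beta v).
- exists x, x; split; try by apply: Ps; rewrite inE eqxx.
  by move: ss => /=; have := beta_bounds v; lia.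
have Px : Pos (rcons h x) by apply: Ps; rewrite inE eqxx.
have Py : Pos (rcons h y) by apply: Ps; rewrite !inE eqxx orbT.
exists x, y; split=> // v0.
have xy : x != y by move: us; rewrite /= inE negb_or => /andP[/andP[]].
have par w : Pos (rcons h w) -> exists k : int,
    h`_0 - w = (c (Ordinal (ltn_trans v0 vn)) : nat)%:Z - (c v : nat)%:Z + 2 * k.
  move=> Pw; have := pos_parity (u := Ordinal (ltn_trans v0 vn)) (v := v) Pw.
  rewrite size_rcons hv /= !nth_rcons hv v0 ltnn eqxx; apply=> //; lia.
have [k xk] := par x Px; have [l yl] := par y Py.
by have := beta_bounds v; lia.
Qed.

(* Adversary answers at the gluing vertex z with the offered value lying
   farther away: the two offered values differ by at least 2 (beta z - 1). *)
Lemma pos_looping (u v : var Psi) s h : looping u s v ->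
  Pos h -> size h = (maxn u v).+1 -> `|h`_u - h`_v| <= lambda s.
Proof.
move=> lp; elim: lp h => {u v s} [u v uv auv|u v z p q uv ltw lp IHp lq IHq] h Ph sh.
  have hn : (size h <= nvars Psi)%N by rewrite sh; have := ltn_ord u; have := ltn_ord v; lia.
  have [t homt ht] := pos_full Ph hn.
  rewrite !ht ?sh; try lia.
  by have := homt _ _ auv; rewrite /lambda big_nil /path_infty /=; lia.
have /andP[uz vz] : (u < z)%N && (v < z)%N.
  by apply: ltw; rewrite mem_cat inE eqxx orbT.
have zn := ltn_ord z.
have [|r Pr sr] := pos_extend (k := z) Ph; first by lia.
have [x [y [Px Py xy]]] := pos_options Pr sr.
have := IHp _ Px; have := IHp _ Py; have := IHq _ Px; have := IHq _ Py.
rewrite !size_rcons !nth_rcons sr ltnn eqxx uz vz !nth_cat sh.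
have -> : (u < (maxn u v).+1)%N by lia.
have -> : (v < (maxn u v).+1)%N by lia.
have -> : maxn u z = z by lia.
have -> : maxn z v = z by lia.
move=> /(_ erefl) A /(_ erefl) C /(_ erefl) D /(_ erefl) F.
have := xy (leq_ltn_trans (leq0n _) uz).
by rewrite lambda_glue; lia.
Qed.

(** Both options for [v] lie within [lambda s] of the value of [u], while they differ by at least
    [2 * (beta v - 1)]. *)
Lemma looping_lambda_ge (u v : var Psi) s : (u < v)%N -> looping u s v ->
  (beta v)%:Z - 1 <= lambda s.
Proof.
move=> uv lp; have vn := ltn_ord v; case: (winP) => Pos0 _ _.
have [|r Pr sr] := pos_extend (k := v) Pos0; first by rewrite /= ltnW.
have [x [y [Px Py xy]]] := pos_options Pr sr.
have := pos_looping lp Px; have := pos_looping lp Py.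
rewrite !size_rcons !nth_rcons sr ltnn eqxx uv.
have -> : maxn u v = v by lia.
by move=> /(_ erefl) A /(_ erefl) C; have := xy (leq_ltn_trans (leq0n _) uv); lia.
Qed.

(** [C] is twice a half-integral centre; doubling keeps everything in the integers, and the oddness
    of [C] gives the extra 1. *)
Lemma pos_gamma (C : int) (v : var Psi) : (C %% 2 = 1)%Z ->
  exists h, [/\ Pos h, size h = v.+1 & 2 * gamma v + 1 <= `|2 * h`_v - C|].
Proof.
move=> C1; case: (winP) => Pos0 _ _.
have [m vm] := ubnP (v : nat); elim: m v vm => // m IHm v vm.
have vn := ltn_ord v.
have last_opt h x : size h = v -> (rcons h x)`_v = x.
  by move=> hv; rewrite nth_rcons hv ltnn eqxx.
rewrite gammaE; case: eqP => [v0|/eqP v0].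
  have [|r Pr sr] := pos_extend (k := v) Pos0; first by rewrite /= ltnW.
  have [x [_ [Px _ _]]] := pos_options Pr sr.
  by exists (rcons r x); split; rewrite ?size_rcons ?sr // last_opt //; lia.
(* It suffices to reach the bound for the default 0 and for each single term of the maximum. *)
apply: (big_ind (fun g => exists h, [/\ Pos h, size h = v.+1 &
  2 * ((beta v)%:Z - 1 + g) + 1 <= `|2 * h`_v - C|])).
- have [|r Pr sr] := pos_extend (k := v) Pos0; first by rewrite /= ltnW.
  have [x [y [Px Py xy]]] := pos_options Pr sr.
  have [A|A] : 2 * (beta v)%:Z - 1 <= `|2 * x - C| \/
               2 * (beta v)%:Z - 1 <= `|2 * y - C|.
      by have := xy ltac:(lia); have := beta_bounds v; lia.
    by exists (rcons r x); split; rewrite ?size_rcons ?sr // last_opt //; lia.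
  by exists (rcons r y); split; rewrite ?size_rcons ?sr // last_opt //; lia.
- by move=> g g' Hg Hg'; case: (leP g g').
move=> u /andP[uv]; have := deltaP u v; case: (delta u v) => // d [[s lp sd] _] _.
have [|h [Ph sh hu]] := IHm u; first by lia.
have [|r Pr sr] := pos_extend (k := v) Ph; first by lia.
have [x [y [Px Py xy]]] := pos_options Pr sr.
have := pos_looping lp Px; have := pos_looping lp Py.
rewrite !size_rcons !nth_rcons sr ltnn eqxx uv nth_cat sh ltnSn.
have -> : maxn u v = v by lia.
rewrite sd /= => /(_ erefl) hy /(_ erefl) hx.
have xy' := xy (leq_ltn_trans (leq0n _) uv); have bv := beta_bounds v.
(* If the value of [u] lies above the centre, the larger option is at least that value minus [d]
   plus [2 * (beta v - 1)]; below the centre, symmetrically. *)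
have [A|A] : 2 * ((beta v)%:Z - 1 + (gamma u - d + (beta v)%:Z - 1)) + 1 <= `|2 * x - C| \/
             2 * ((beta v)%:Z - 1 + (gamma u - d + (beta v)%:Z - 1)) + 1 <= `|2 * y - C|.
    by move: (gamma u) h`_u (beta v) hu hx hy xy' bv => g a b; lia.
  by exists (rcons (h ++ r) x); split; rewrite ?size_rcons ?sr // last_opt.
by exists (rcons (h ++ r) y); split; rewrite ?size_rcons ?sr // last_opt.
Qed.

(** * Prover's side: inequalities for delta and gamma, and the safe strategy *)

Lemma looping_interior (u v w : var Psi) s : looping u s v -> w \in s ->
  (u < w)%N && (v < w)%N.
Proof. by case=> // x y z p q _ ltw _ _ /ltw. Qed.

Lemma delta_walk (u v : var Psi) d : delta u v = Some d ->
  exists2 s, looping u s v & lambda s = d.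
Proof. by move=> uvd; have := deltaP u v; rewrite uvd => -[]. Qed.

Lemma delta_le (u v : var Psi) s : looping u s v ->
  exists2 d, delta u v = Some d & d <= lambda s.
Proof.
move=> lp; have := deltaP u v; case: (delta u v) => [d [_ min_d]|/(_ s)//].
by exists d => //; apply: min_d.
Qed.

(** Since [v] comes after both [u] and [w], the walk from [u] to [v] and the reversed walk from [w]
    to [v] glue at [v]. *)
Lemma delta_glue (u v w : var Psi) d e : (u < w < v)%N ->
  delta u v = Some d -> delta w v = Some e ->
  exists2 k, delta u w = Some k & k <= d + e - 2 * ((beta v)%:Z - 1).
Proof.
move=> /andP[uw wv] /delta_walk[p lp <-] /delta_walk[q lq <-].
rewrite -(lambda_rev q) -lambda_glue; apply: delta_le.
have wu : u != w by rewrite neq_ltn uw.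
apply: (looping_glue wu _ lp (looping_rev lq)).
move=> z; rewrite mem_cat inE mem_rev => /or3P[|/eqP ->|].
- by move/(looping_interior lp); lia.
- by lia.
- by move/(looping_interior lq); lia.
Qed.

Lemma gamma_ge (v : var Psi) : (0 < v)%N -> (beta v)%:Z - 1 <= gamma v.
Proof.
by rewrite gammaE lt0n => /negPf ->; rewrite lerDl bigmax_ge_id.
Qed.

Lemma gamma_step (u v : var Psi) d : (u < v)%N -> delta u v = Some d ->
  2 * ((beta v)%:Z - 1) + gamma u - d <= gamma v.
Proof.
move=> uv uvd; rewrite (gammaE v) ifF; last by lia.
set F := fun u : var Psi => gamma u - odflt 0 (delta u v) + (beta v)%:Z - 1.
have := @le_bigmax_cond _ _ _ 0 u (fun u => (u < v)%N && delta u v) F.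
rewrite uv uvd {1}/F uvd /= => /(_ isT).
by move: (gamma u) (\big[_/_]_(_ | _) _) => g S; lia.
Qed.

(* The board {1, ..., 2m} is shifted to {0, ..., 2m - 1}, whose centre is
   m - 1/2. *)
Definition safe (m : int) (h : seq int) : Prop :=
  [/\ forall (u v : var Psi) d, (u < v < size h)%N -> delta u v = Some d ->
        `|h`_u - h`_v| <= d,
      forall v : var Psi, (v < size h)%N ->
        `|2 * h`_v - (2 * m - 1)| <= 2 * gamma v + 1 &
      forall u v : var Psi, (u < v < size h)%N ->
        exists k : int, h`_u - h`_v = (c u : nat)%:Z - (c v : nat)%:Z + 2 * k].

Lemma safe_rcons m h (v : var Psi) x : size h = v -> safe m h ->
  (forall (u : var Psi) d, (u < v)%N -> delta u v = Some d -> `|h`_u - x| <= d) ->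
  `|2 * x - (2 * m - 1)| <= 2 * gamma v + 1 ->
  (forall u : var Psi, (u < v)%N ->
    exists k : int, h`_u - x = (c u : nat)%:Z - (c v : nat)%:Z + 2 * k) ->
  safe m (rcons h x).
Proof.
move=> hv [hd hg hp] xd xg xp.
have last_case (w : var Psi) : (w < v.+1)%N -> w = v \/ (w < v)%N.
  by rewrite ltnS leq_eqVlt => /orP[/eqP/val_inj ->|]; [left|right].
have nth_old (w : var Psi) : (w < v)%N -> (rcons h x)`_w = h`_w.
  by move=> wv; rewrite nth_rcons hv wv.
have nth_new : (rcons h x)`_v = x by rewrite nth_rcons hv ltnn eqxx.
split; rewrite size_rcons hv.
- move=> u w d /andP[uw /last_case[wv|wv]] uwd.
    by rewrite wv in uw uwd *; rewrite nth_new nth_old //; apply: xd.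
  rewrite !nth_old //; last by lia.
  by apply: hd => //; rewrite hv uw.
- move=> w /last_case[->|wv]; first by rewrite nth_new.
  by rewrite nth_old //; apply: hg; rewrite hv.
- move=> u w /andP[uw /last_case[wv|wv]].
    by rewrite wv in uw *; rewrite nth_new nth_old //; apply: xp.
  rewrite !nth_old //; last by lia.
  by apply: hp; rewrite hv uw.
Qed.

(* One-dimensional Helly: the admissible interval is the intersection of the
   intervals of radius delta u v around the values of the earlier vertices u
   with the interval of radius gamma v around the centre. *)
Lemma safe_interval m h (v : var Psi) : (0 < v)%N -> size h = v -> safe m h ->
  exists L : int, forall x : int,
    x = L \/ x = L + 2 * ((beta v)%:Z - 1) -> safe m (rcons h x).
Proof.
move=> v0 hv sh; have [hd hg hp] := sh; have vn := ltn_ord v.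
pose o : var Psi := Ordinal (ltn_trans v0 vn).
have bv := beta_bounds v; have gv := gamma_ge v0.
have [r par_h] : exists r : int, forall u : var Psi, (u < v)%N ->
    exists k : int, h`_u = r + (c u : nat)%:Z - (c v : nat)%:Z + 2 * k.
  exists (h`_0 - (c o : nat)%:Z + (c v : nat)%:Z) => u uv.
  have [u0|u0] := posnP u.
    have -> : u = o by apply: val_inj.
    by exists 0; rewrite /=; lia.
  have [|k] := hp o u; first by rewrite /= u0 hv.
  rewrite /= => hk; exists (- k).
  by move: h`_0 h`_u (c o) (c u) hk => a b i j; lia.
have par_d (u : var Psi) d : (u < v)%N -> delta u v = Some d ->
    (exists k : int, h`_u - d = r + 2 * k) /\
    (exists k : int, h`_u + d = r + 2 * k).
  move=> uv /delta_walk[s /looping_parity[l sl] <-]; have [k hk] := par_h u uv.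
  split; [exists (k - l)|exists (k + l + (c u : nat)%:Z - (c v : nat)%:Z)]; lia.
(* The central interval runs from [m - 1 - gamma v] to [m + gamma v]. Its lower end is rounded up to
   the parity class of [v]; [low + 2 * gamma v] is then its largest element of that class. *)
have [low [low_par low_bd]] : exists low : int,
    (exists k : int, low = r + 2 * k) /\ m - 1 - gamma v <= low <= m - gamma v.
  exists (m - 1 - gamma v + modz (m - 1 - gamma v - r) 2).
  split; last by lia.
  by exists (divz (m - gamma v - r) 2); move: (gamma v) => g; lia.
pose P (u : var Psi) := (u < v)%N && isSome (delta u v).
pose F (u : var Psi) := h`_u - odflt 0 (delta u v).
(* The greatest lower end of all the intervals, with [low] as the default for the central one. *)
pose L := \big[Num.max/low]_(u | P u) F u.
have L_par : exists k : int, L = r + 2 * k.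
  apply: (big_ind (fun x => exists k : int, x = r + 2 * k)) => //.
    by move=> x y px py; case: (leP x y).
  move=> u /andP[uv]; rewrite /F; case uvd: (delta u v) => [d|//] _.
  by have [] := par_d u d uv uvd.
have low_L : low <= L by apply: bigmax_ge_id.
have L_ge (u : var Psi) d : (u < v)%N -> delta u v = Some d -> h`_u - d <= L.
  move=> uv uvd; have := @le_bigmax_cond _ _ _ low u P F.
  by rewrite /P /F uv uvd /=; apply.
have L_le M : low <= M ->
    (forall (u : var Psi) d, (u < v)%N -> delta u v = Some d -> h`_u - d <= M) ->
    L <= M.
  move=> lowM uM; apply: bigmax_le => // u /andP[uv]; rewrite /F.
  by case uvd: (delta u v) => [d|//] _; apply: uM.
(* Lower ends against the top of the central interval: [gamma_step] gives the bound, and equal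
   parity recovers the unit lost by rounding. *)
have L_top : L + 2 * ((beta v)%:Z - 1) <= low + 2 * gamma v.
  suff : L <= low + 2 * gamma v - 2 * ((beta v)%:Z - 1) by lia.
  apply: L_le => [|u d uv uvd]; first by lia.
  have [[k uk] _] := par_d u d uv uvd; have [l lowl] := low_par.
  have := gamma_step uv uvd; have := hg u; rewrite hv => /(_ uv).
  by move: (gamma v) (gamma u) h`_u low_bd uk => g g' x; lia.
have L_up (w : var Psi) e : (w < v)%N -> delta w v = Some e ->
    L + 2 * ((beta v)%:Z - 1) <= h`_w + e.
  move=> wv wve; suff : L <= h`_w + e - 2 * ((beta v)%:Z - 1) by lia.
  apply: L_le => [|u d uv uvd].
    have [_ [k wk]] := par_d w e wv wve; have [l lowl] := low_par.
    have := gamma_step wv wve; have := hg w; rewrite hv => /(_ wv).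
    by move: (gamma v) (gamma w) h`_w low_bd wk => g g' x; lia.
  (* For distinct [u] and [w], gluing at [v] bounds the delta between them; for equal ones the claim
     is [beta v - 1 <= delta u v]. *)
  have [uw|wu|/val_inj uw] := ltngtP u w.
  - have [|k uwk] := @delta_glue u v w d e _ uvd wve; first by rewrite uw.
    by have := hd u w k; rewrite hv uw wv => /(_ isT uwk); lia.
  - have [|k wuk] := @delta_glue w v u e d _ wve uvd; first by rewrite wu.
    by have := hd w u k; rewrite hv wu uv => /(_ isT wuk); lia.
  - move: uvd; rewrite uw wve => -[<-].
    by have [s /(looping_lambda_ge wv) + <-] := delta_walk wve; lia.
exists L => x xL; have [k Lk] := L_par.
have {}xL : L <= x <= L + 2 * ((beta v)%:Z - 1) /\ exists l : int, x = r + 2 * l.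
  by case: xL => ->; (split; [lia|]); [exists k|exists (k + (beta v)%:Z - 1)]; lia.
case: xL => xL [l xl]; apply: (safe_rcons hv sh).
- by move=> u d uv uvd; have := L_ge u d uv uvd; have := L_up u d uv uvd; lia.
- have [j lowj] := low_par.
  by clearbody L; move: (gamma v) low_bd L_top => g; lia.
- by move=> u uv; have [j ->] := par_h u uv; exists (j - l); lia.
Qed.

Lemma safe_winning m : winning path_infty Psi (safe m).
Proof.
split=> [|v h hv sh|t [td _ tp] u v uv].
- by split=> // u v; rewrite andbF.
- have [v0|v0] := posnP v.
    have g0 : gamma v = 0 by rewrite gammaE v0.
    (* The two elements nearest the centre, at doubled distance 1. *)
    exists [:: m; m - 1]; split=> [||x].
    - by rewrite /= inE andbT; lia.
    - by case/andP: (beta_bounds v).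
    - rewrite !inE => xm; apply: (safe_rcons hv sh); rewrite ?g0 ?v0 //.
      by move: xm; lia.
  have [L Ls] := safe_interval v0 hv sh.
  exists (take (beta v) [:: L; L + 2 * ((beta v)%:Z - 1)]).
  have := beta12 v; rewrite !inE => /orP[] /eqP b; rewrite b in Ls *; split=> //.
  - by move=> x; rewrite inE => /eqP ->; apply: Ls; left.
  - by rewrite /= inE andbT; lia.
  - by move=> x; rewrite !inE => /orP[] /eqP ->; apply: Ls; [left|right].
wlog uv' : u v uv / (u < v)%N => [IH|].
  have [uv'|vu|/val_inj uv'] := ltngtP u v; first exact: IH.
    by rewrite path_infty_sym IH // adj_sym.
  by have := c_adj uv; rewrite uv' eqxx.
(* An edge forces delta at most 1, and the differing colours make the distance odd, hence exactly
   1. *)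
have := delta_le (looping_edge _ uv); case; first by rewrite neq_ltn uv'.
move=> d uvd; rewrite /lambda big_nil /= => d1.
have uvt : (u < v < size t)%N by rewrite uv' size_tuple ltn_ord.
have := td u v d uvt uvd; have [k] := tp u v uvt.
rewrite !(tnth_nth 0) /path_infty /=; have := c_adj uv.
move: t`_u t`_v => x y.
by case: (c u) (c v) => [] [] //= _; lia.
Qed.

Lemma safe_bounded (m : int) h : safe m h -> (size h <= nvars Psi)%N ->
  (forall v : var Psi, gamma v < m) -> {in h, forall x, 0 <= x < 2 * m}.
Proof.
move=> [_ hg _] hn gm x /(nthP 0)[i ih <-].
have := hg (Ordinal (leq_trans ih hn)) ih; have := gm (Ordinal (leq_trans ih hn)).
by rewrite /=; move: (gamma _) h`_i => g y; lia.
Qed.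

End WinningPositions.

(** * Return to the path on [n] vertices *)

Theorem theorem26 (n : nat) (Psi : instance) :
  (4 <= n)%N -> ~~ odd n ->
  connected Psi -> bipartite Psi ->
  models path_infty Psi ->
  (models (@path_fin n) Psi <-> prover_wins (@path_fin n) Psi) /\
  (prover_wins (@path_fin n) Psi <->
     ~ exists v : 'I_(nvars Psi), (n./2)%:Z <= gamma v).
Proof.
move=> n4 n_even conn [c c_adj].
move=> /(modelsP _ path_infty_sym)[Pinf win_inf].
have n0 : (0 < n)%N by lia.
have n1 : (1 < n)%N by lia.
have ab : Ordinal n0 != Ordinal n1 by [].
rewrite (modelsP _ (@path_fin_sym n)) (prover_winsP _ _ ab).
split=> //; split=> [[Pos /winning_fin_infty win] [v gv]|no].
  (* The doubled centre of {0, ..., n - 1} is [n - 1]. Elements of the board are at doubled distance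
     at most [n - 1] from it, whereas [gamma v >= n / 2] would force [n + 1]. *)
  have C1 : modz (n%:Z - 1) 2 = 1 by lia.
  have [h [[g _ ->] sh]] := pos_gamma conn c_adj win v C1.
  rewrite size_map in sh; rewrite (nth_map (Ordinal n0)) ?sh //.
  have := ltn_ord (nth (Ordinal n0) g v); move: (nat_of_ord _) (gamma v) gv.
  by move=> x y; lia.
have gm (v : var Psi) : gamma v < (n./2)%:Z.
  by rewrite ltNge; apply/negP => gv; apply: no; exists v.
have win := safe_winning conn c_adj win_inf (n./2)%:Z.
exists (fun g => safe c (n./2)%:Z [seq (nat_of_ord i)%:Z | i <- g]).
apply: winning_infty_fin win _ => // h sh hn x xh.
have := safe_bounded sh hn gm xh.
by have := even_halfK n_even; lia.
Qed.
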